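(* Let $P$ be a TRAP. Define a vertical concatenation $\circ$ by: for all $(k,l,m)\in\mathbb N_0^3$, $p\in P(k,l)$, $q\in P(l,m)$, $$q\circ p=t_{k+1,1}\circ\cdots\circ t_{k+l-1,l-1}\circ t_{k+l,l}(p*q)\in P(k,m).$$ This operation is associative: for any $(k,l,m,n)\in\mathbb N_0^4$ and any $(p,q,r)\in P(k,l)\times P(l,m)\times P(m,n)$, $r\circ(q\circ p)=(r\circ q)\circ p$. If the TRAP $P$ is unitary with unit $I_P$, then for any $(k,l)\in\mathbb N_0^2$ and any $p\in P(k,l)$, $$I_P^{*l}\circ p=p\circ I_P^{*k}=p.$$
   Context: Notation: $\mathbb{N}_0=\{0,1,2,\dots\}$, $[k]=\{1,\dots,k\}$, $\mathfrak S_k$ is the symmetric group on $[k]$; $I_P^{*n}$ is the $n$-fold horizontal concatenation of $I_P$ with itself ($I_P^{*0}=I_0$). TRAP. A TRAP is a family $P=(P(k,l))_{k,l\ge 0}$ of sets with: (1) for all $k,l\in\mathbb N_0$, a left action of $\mathfrak S_l$ and a right action of $\mathfrak S_k$ on $P(k,l)$ which commute (this is called an $\mathfrak S\times\mathfrak S^{op}$-module). (2) Maps $*:P(k,l)\times P(k',l')\to P(k+k',l+l')$ (horizontal concatenation) such that: $*$ is associative; there is $I_0\in P(0,0)$ with $I_0*p=p*I_0=p$; $(\sigma\cdot p\cdot\tau)*(\sigma'\cdot p'\cdot\tau')=(\sigma\otimes\sigma')\cdot(p*p')\cdot(\tau\otimes\tau')$, where for $\alpha\in\mathfrak S_m,\beta\in\mathfrak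 S_n$, $(\alpha\otimes\beta)(i)=\alpha(i)$ if $i\le m$ and $\beta(i-m)+m$ if $i>m$; and $c_{l,l'}\cdot(p*p')=(p'*p)\cdot c_{k,k'}$ for $p\in P(k,l)$, $p'\in P(k',l')$, where $c_{m,n}\in\mathfrak S_{m+n}$, $c_{m,n}(i)=i+n$ if $i\le m$ and $i-m$ if $i>m$. (3) For $k,l\ge1$, $i\in[k]$, $j\in[l]$, maps $t_{i,j}:P(k,l)\to P(k-1,l-1)$ (partial trace maps) such that: (a) for $k,l\ge2$, $i\in[k]$, $j\in[l]$, $i'\in[k-1]$, $j'\in[l-1]$: $t_{i',j'}\circ t_{i,j}$ equals $t_{i-1,j-1}\circ t_{i',j'}$ if $i'<i,j'<j$; $t_{i,j-1}\circ t_{i'+1,j'}$ if $i'\ge i,j'<j$; $t_{i-1,j}\circ t_{i',j'+1}$ if $i'<i,j'\ge j$; $t_{i,j}\circ t_{i'+1,j'+1}$ if $i'\ge i,j'\ge j$. (b) $t_{i,j}(\sigma\cdot p\cdot\tau)=\sigma_j\cdot t_{\tau(i),\sigma^{-1}(j)}(p)\cdot\tau_{\tau(i)}$, where for $\alpha\in\mathfrak S_n$ and $q\in[n]$, $\alpha_q\in\mathfrak S_{n-1}$ is the permutation whose word is obtained from the word $\alpha(1)\dots\alpha(n)$ by deleting the letter $q$ and subtracting $1$ from all letters $>q$. (c) for $p\in P(k,l)$, $p'\in P(k',l')$ ($k,l,k',l'\ge0$), $i\in[k+k']$, $j\in[l+l']$: $t_{i,j}(p*p')=t_{i,j}(p)*p'$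 if $i\le k,j\le l$, and $t_{i,j}(p*p')=p*t_{i-k,j-l}(p')$ if $i>k,j>l$. The TRAP is unitary if there is $I\in P(1,1)$ (the unit) such that for all $k,l\ge0$ and $p\in P(k,l)$: $t_{1,j}(I*p)=(1,2,\dots,j-1)\cdot p$ for $2\le j\le l+1$; $t_{i,1}(I*p)=p\cdot(1,2,\dots,i-1)^{-1}$ for $2\le i\le k+1$; $t_{k+1,j}(p*I)=(j,j+1,\dots,l)^{-1}\cdot p$ for $1\le j\le l$; $t_{i,l+1}(p*I)=p\cdot(i,i+1,\dots,k)$ for $1\le i\le k$ (here $(a,\dots,b)$ denotes a cycle). *)

(* Defs.v *)
From mathcomp Require Import all_boot all_fingroup.

Set Implicit Arguments.
Unset Strict Implicit.
Unset Printing Implicit Defensive.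

(* Everything is 0-indexed: the letter i of [n] = {1, ..., n} is the element  *)
(* i - 1 of 'I_n.  The product of 'S_n satisfies (s * t) i = t (s i), so that *)
(* the composite "s o t" of functions is (t * s)%g.                           *)

Section Permutations.
Local Open Scope group_scope.

Section Juxtaposition.
Variables (m n : nat) (a : 'S_m) (b : 'S_n).

Definition otimes_fun (i : 'I_(m + n)) : 'I_(m + n) :=
  match split i with
  | inl j => lshift n (a j)
  | inr j => rshift m (b j)
  end.

Lemma otimes_fun_inj : injective otimes_fun.
Proof.
move=> i j; rewrite /otimes_fun -{2}(splitK i) -{2}(splitK j).
case: (split i) => i'; case: (split j) => j' /eqP /=.
- by rewrite eq_lshift => /eqP /perm_inj ->.
- by rewrite eq_lrshift.
- by rewrite eq_rlshift.
- by rewrite eq_rshift => /eqP /perm_inj ->.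
Qed.

Definition otimes : 'S_(m + n) := perm otimes_fun_inj.

End Juxtaposition.

Section BlockSwap.
Variables m n : nat.

Definition blockswap_fun (i : 'I_(m + n)) : 'I_(m + n) :=
  cast_ord (addnC n m)
    match split i with
    | inl j => rshift n j
    | inr j => lshift m j
    end.

Lemma blockswap_fun_inj : injective blockswap_fun.
Proof.
move=> i j /cast_ord_inj; rewrite -{2}(splitK i) -{2}(splitK j).
case: (split i) => i'; case: (split j) => j' /eqP /=.
- by rewrite eq_rshift => /eqP ->.
- by rewrite eq_rlshift.
- by rewrite eq_lrshift.
- by rewrite eq_lshift => /eqP ->.
Qed.

(* c_{m,n} : i |-> i + n on the first m letters, i |-> i - m on the last n.   *)
Definition blockswap : 'S_(m + n) := perm blockswap_fun_inj.

End BlockSwap.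

Section DeleteLetter.
Variables (n : nat) (a : 'S_n.+1) (q : 'I_n.+1).

(* The letter q of the word of a stands at the position a^-1 q: [lift] skips  *)
(* this position and [unlift q] shifts down the letters greater than q (its   *)
(* argument is never q, so that the default value of [odflt] is irrelevant).  *)
Definition del_letter_fun (i : 'I_n) : 'I_n :=
  odflt i (unlift q (a (lift (a^-1 q) i))).

Lemma lift_del_letter_fun i :
  lift q (del_letter_fun i) = a (lift (a^-1 q) i).
Proof.
rewrite /del_letter_fun; case: unliftP => [j ->//|] /= /(canRL (permK a)).
by move=> /eqP; rewrite eq_sym (negPf (neq_lift _ _)).
Qed.

Lemma del_letter_fun_inj : injective del_letter_fun.
Proof.
by move=> i j /(congr1 (lift q)); rewrite !lift_del_letter_fun
  => /perm_inj /lift_inj.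
Qed.

Definition del_letter : 'S_n := perm del_letter_fun_inj.

End DeleteLetter.

(* The cycle (a, a+1, ..., b); it is the identity if a >= b.                  *)
Definition interval_cycle n (a b : nat) : 'S_n :=
  perm (can_inj (prev_next
    (filter_uniq (fun i : 'I_n => a <= i <= b) (enum_uniq 'I_n)))).

End Permutations.

Definition cast2 (P : nat -> nat -> Type) k k' l l' (ek : k = k') (el : l = l')
    (p : P k l) : P k' l' :=
  ecast i (P i l') ek (ecast j (P k j) el p).

Record trap := Trap {
  trap_sort :> nat -> nat -> Type;

  actl : forall k l, 'S_l -> trap_sort k l -> trap_sort k l;
  actr : forall k l, trap_sort k l -> 'S_k -> trap_sort k l;
  actl1 : forall k l (p : trap_sort k l), actl 1%g p = p;
  actlM : forall k l (s s' : 'S_l) (p : trap_sort k l),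
    actl (s' * s)%g p = actl s (actl s' p);
  actr1 : forall k l (p : trap_sort k l), actr p 1%g = p;
  actrM : forall k l (p : trap_sort k l) (t t' : 'S_k),
    actr p (t' * t)%g = actr (actr p t) t';
  actlr : forall k l (s : 'S_l) (p : trap_sort k l) (t : 'S_k),
    actl s (actr p t) = actr (actl s p) t;

  hcat : forall k l k' l',
    trap_sort k l -> trap_sort k' l' -> trap_sort (k + k') (l + l');
  hcatA : forall k l k' l' k'' l''
      (p : trap_sort k l) (p' : trap_sort k' l') (p'' : trap_sort k'' l''),
    cast2 (addnA k k' k'') (addnA l l' l'') (hcat p (hcat p' p''))
      = hcat (hcat p p') p'';
  hunit : trap_sort 0 0;
  hcat1p : forall k l (p : trap_sort k l), hcat hunit p = p;
  hcatp1 : forall k l (p : trap_sort k l),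
    cast2 (addn0 k) (addn0 l) (hcat p hunit) = p;
  hcat_act : forall k l k' l' (s : 'S_l) (p : trap_sort k l) (t : 'S_k)
      (s' : 'S_l') (p' : trap_sort k' l') (t' : 'S_k'),
    hcat (actr (actl s p) t) (actr (actl s' p') t')
      = actr (actl (otimes s s') (hcat p p')) (otimes t t');
  hcatC : forall k l k' l' (p : trap_sort k l) (p' : trap_sort k' l'),
    actl (blockswap l l') (hcat p p')
      = actr (cast2 (addnC k' k) (addnC l' l) (hcat p' p)) (blockswap k k');

  ptrace : forall k l,
    'I_k.+1 -> 'I_l.+1 -> trap_sort k.+1 l.+1 -> trap_sort k l;
  (* All the arguments of [inord] below are within the bounds.                *)
  ptrace_ltlt : forall k l (i : 'I_k.+2) (j : 'I_l.+2)
      (i' : 'I_k.+1) (j' : 'I_l.+1) (p : trap_sort k.+2 l.+2),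
    i' < i -> j' < j ->
    ptrace i' j' (ptrace i j p)
      = ptrace (inord i.-1) (inord j.-1) (ptrace (inord i') (inord j') p);
  ptrace_gelt : forall k l (i : 'I_k.+2) (j : 'I_l.+2)
      (i' : 'I_k.+1) (j' : 'I_l.+1) (p : trap_sort k.+2 l.+2),
    i <= i' -> j' < j ->
    ptrace i' j' (ptrace i j p)
      = ptrace (inord i) (inord j.-1) (ptrace (inord i'.+1) (inord j') p);
  ptrace_ltge : forall k l (i : 'I_k.+2) (j : 'I_l.+2)
      (i' : 'I_k.+1) (j' : 'I_l.+1) (p : trap_sort k.+2 l.+2),
    i' < i -> j <= j' ->
    ptrace i' j' (ptrace i j p)
      = ptrace (inord i.-1) (inord j) (ptrace (inord i') (inord j'.+1) p);
  ptrace_gege : forall k l (i : 'I_k.+2) (j : 'I_l.+2)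
      (i' : 'I_k.+1) (j' : 'I_l.+1) (p : trap_sort k.+2 l.+2),
    i <= i' -> j <= j' ->
    ptrace i' j' (ptrace i j p)
      = ptrace (inord i) (inord j) (ptrace (inord i'.+1) (inord j'.+1) p);
  ptrace_act : forall k l (i : 'I_k.+1) (j : 'I_l.+1)
      (s : 'S_l.+1) (p : trap_sort k.+1 l.+1) (t : 'S_k.+1),
    ptrace i j (actr (actl s p) t)
      = actr (actl (del_letter s j) (ptrace (t i) (s^-1%g j) p))
          (del_letter t (t i));
  ptrace_hcatl : forall k l k' l' (i : 'I_k.+1) (j : 'I_l.+1)
      (p : trap_sort k.+1 l.+1) (p' : trap_sort k' l'),
    @ptrace (k + k') (l + l') (lshift k' i) (lshift l' j) (hcat p p')
      = hcat (ptrace i j p) p';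
  ptrace_hcatr : forall k l k' l' (i : 'I_k'.+1) (j : 'I_l'.+1)
      (p : trap_sort k l) (p' : trap_sort k'.+1 l'.+1),
    ptrace (cast_ord (addnS k k') (rshift k i))
           (cast_ord (addnS l l') (rshift l j))
           (cast2 (addnS k k') (addnS l l') (hcat p p'))
      = hcat p (ptrace i j p')
}.

Arguments hunit : clear implicits.

(* In each line, j (resp. i) is the index j - 1 (resp. i - 1) of the          *)
(* 1-indexed axiom.                                                           *)
Record is_trap_unit (P : trap) (I : P 1 1) : Prop := IsTrapUnit {
  ptrace_unit_hcat_out : forall k l (p : P k l) (j : 'I_l.+1), 0 < j ->
    @ptrace P k l ord0 j (hcat I p) = actl (interval_cycle l 0 j.-1) p;
  ptrace_unit_hcat_in : forall k l (p : P k l) (i : 'I_k.+1), 0 < i ->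
    @ptrace P k l i ord0 (hcat I p) = actr p (interval_cycle k 0 i.-1)^-1%g;
  ptrace_hcat_unit_out : forall k l (p : P k l) (j : 'I_l.+1), j < l ->
    ptrace ord_max j (cast2 (addn1 k) (addn1 l) (hcat p I))
      = actl (interval_cycle l j l.-1)^-1%g p;
  ptrace_hcat_unit_in : forall k l (p : P k l) (i : 'I_k.+1), i < k ->
    ptrace i ord_max (cast2 (addn1 k) (addn1 l) (hcat p I))
      = actr p (interval_cycle k i k.-1)
}.

Fixpoint hpow (P : trap) (I : P 1 1) (n : nat) : P n n :=
  match n with
  | 0 => hunit P
  | n'.+1 => hcat I (hpow I n')
  end.

(* t_{k+1,1} o ... o t_{k+l-1,l-1} o t_{k+l,l}; the trace t_{k+l,l} is        *)
(* applied first.                                                             *)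
Fixpoint iter_ptrace (P : trap) (k l m : nat) : P (k + l) (l + m) -> P k m :=
  match l with
  | 0 => fun x => cast2 (addn0 k) (add0n m) x
  | l'.+1 => fun x =>
      iter_ptrace
        (@ptrace P (k + l') (l' + m)
           (inord (k + l')) (inord l')
           (cast2 (addnS k l') (addSn l' m) x))
  end.

Definition vcomp (P : trap) k l m (q : P l m) (p : P k l) : P k m :=
  iter_ptrace (hcat p q).

(* Main.v *)
Require Import Defs.
From mathcomp Require Import all_boot all_fingroup.

(** In this comment indices start at 1, as in the usual notation t_{i,j}; the
    lemmas below number from 0, so that t_{k+1,1} is [tr k 0].

    The traces in a vertical concatenation are nested: t_{k+l,l} is taken
    first, then t_{k+l-1,l-1}, and so on down to t_{k+1,1}.  When i' < i and
    j' < j, the commutation axiom lets t_{i',j'} be taken before t_{i,j}, whose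
    indices then drop by one.  Repeating this shows that the whole composite is
    the l-th iterate of the single map T = t_{k+1,1} ([iter_slide]).  Hence
    q o p is T^l (p * q) ([pack_vcomp]).

    Associativity becomes a count of traces on p * q * r.  On one side,
    r o (q o p) = T^m (T^l (p * q) * r) = T^(m + l) (p * q * r), as traces of
    a left factor are traces of the concatenation.  On the other side,
    (r o q) o p = T^l (t_{k+l+1,l+1}^m (p * q * r)), and sliding T^l past each
    of the m inner traces turns it into a further T ([iter_slide_iter]).

    For the units, let c be the full cycle of [l].  One trace of p * I gives
    c^-1 . p, and the other copies of I stay aside, so that T^l (p * I^{*l})
    is c^-l . p = p.  On the other side, let c be the full cycle of [k]; the k
    traces are taken in the original order: t_{k+n,n} only meets the last copy
    of I in I^{*n} * p and turns p into p . c^-1, and c^-k = 1.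

    All the reindexings by equalities such as k + (l + m) = (k + l) + m
    disappear once the elements of all the P(k,l) are gathered into a single
    type, where horizontal concatenation is strictly associative and traces
    are indexed by natural numbers. *)

Set Implicit Arguments.
Unset Strict Implicit.
Unset Printing Implicit Defensive.

(** * The full cycle *)

(** The interval consists of all the letters: the permutation sends each of
    them to the next one in the enumeration, which is a single orbit. *)
Lemma interval_cycle_expgn n : (interval_cycle n 0 n.-1 ^+ n)%g = 1%g.
Proof.
have all_in (i : 'I_n) : (0 <= i <= n.-1) = true.
  by rewrite /= -ltnS (ltn_predK (ltn_ord i)) ltn_ord.
have cycleE : interval_cycle n 0 n.-1 =1 next (enum 'I_n).
  by move=> i; rewrite permE (eq_filter all_in) filter_predT.
apply/permP => i; rewrite permX perm1 (eq_iter cycleE).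
have Ui := enum_uniq 'I_n; have i_in : i \in enum 'I_n by rewrite mem_enum.
have := iter_order_cycle (cycle_next Ui) i_in i_in.
by rewrite (order_cycle (cycle_next Ui)) // size_enum_ord.
Qed.

(** * Elements of all arities *)

Section Packing.
Variable P : trap.

(** The arities are data here, so that elements whose arities are equal without
    being convertible can be compared by plain equality. *)
Definition elt := {kl : nat * nat & P kl.1 kl.2}.

Definition pack k l (p : P k l) : elt :=
  existT (fun kl : nat * nat => P kl.1 kl.2) (k, l) p.

Definition dom (x : elt) := (tag x).1.
Definition cod (x : elt) := (tag x).2.

(** Equality of arities is decidable, hence has a unique proof; this brings
    equations between packed elements back to each P(k,l). *)
Lemma pack_inj k l : injective (@pack k l).
Proof.
by move=> p q e; have := projT2_eq e; rewrite (eq_axiomK (projT1_eq e)).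
Qed.

Lemma pack_cast k k' l l' (ek : k = k') (el : l = l') (p : P k l) :
  pack (cast2 ek el p) = pack p.
Proof. by case: k' / ek; case: l' / el. Qed.

Definition pcat (x y : elt) : elt := pack (hcat (tagged x) (tagged y)).

Lemma pcatA : associative pcat.
Proof.
move=> [[k l] p] [[k' l'] p'] [[k'' l''] p'']; rewrite /pcat /=.
by rewrite -hcatA pack_cast.
Qed.

Lemma pcat1p : left_id (pack (hunit P)) pcat.
Proof. by move=> [[k l] p]; rewrite /pcat /= hcat1p. Qed.

Lemma pcatp1 : right_id (pack (hunit P)) pcat.
Proof.
move=> [[k l] p].
by rewrite -[RHS]/(pack p) -[in RHS](hcatp1 p) pack_cast.
Qed.

(** The value is the partial trace when i < dom x and j < cod x; the other
    values are defaults that make iterated traces total. *)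
Definition tr (i j : nat) (x : elt) : elt :=
  let: existT kl p := x in
  match kl return P kl.1 kl.2 -> elt with
  | (k.+1, l.+1) => fun p => pack (ptrace (inord i) (inord j) p)
  | (k, l) => fun p => pack p
  end p.

Lemma dom_tr i j x : 0 < cod x -> dom (tr i j x) = (dom x).-1.
Proof. by case: x => [[[|k] [|l]] p]. Qed.

Lemma cod_tr i j x : 0 < dom x -> cod (tr i j x) = (cod x).-1.
Proof. by case: x => [[[|k] [|l]] p]. Qed.

Lemma arity_iter_tr n i j x : n <= dom x -> n <= cod x ->
  dom (iter n (tr i j) x) = dom x - n /\ cod (iter n (tr i j) x) = cod x - n.
Proof.
elim: n => [|n IHn] ldx lcx; first by rewrite !subn0.
have [dn cn] := IHn (ltnW ldx) (ltnW lcx).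
by rewrite iterS dom_tr ?cod_tr ?dn ?cn ?subn_gt0 // !subnS.
Qed.

Lemma tr_tr i j i' j' x : i' < i < dom x -> j' < j < cod x ->
  tr i' j' (tr i j x) = tr i.-1 j.-1 (tr i' j' x).
Proof.
case: x => [[[|[|k]] [|[|l]]] p] /=;
  rewrite /dom /cod /= ?ltnS ?leqn0 => /andP[];
  try by case: i => [|i]; rewrite ?ltnn.
  by move=> _ _ /andP[]; case: j => [|j].
move=> lti' lti /andP[ltj' ltj].
by rewrite ptrace_ltlt ?inordK //; eauto using leq_trans.
Qed.

Lemma tr_pcatl i j x y : i < dom x -> j < cod x ->
  tr i j (pcat x y) = pcat (tr i j x) y.
Proof.
case: x => [[[|k] [|l]] p] //; case: y => [[k' l'] p'] lti ltj.
rewrite /pcat /= -ptrace_hcatl; congr (pack (ptrace _ _ _)); apply/val_inj;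
  by rewrite /= !inordK // (leq_trans lti, leq_trans ltj) // ltnS leq_addr.
Qed.

Lemma tr_pcatr i j x y : i < dom y -> j < cod y ->
  tr (dom x + i) (cod x + j) (pcat x y) = pcat x (tr i j y).
Proof.
case: x => [[k l] p]; case: y => [[[|k'] [|l']] p'] // lti ltj.
rewrite -[pcat _ _](pack_cast (addnS k k') (addnS l l') (hcat p p')).
rewrite /pcat /= -ptrace_hcatr.
congr (pack (ptrace _ _ _)); apply/val_inj;
  by rewrite /= !inordK // ltnS leq_add2l -ltnS.
Qed.

Lemma iter_tr_pcatl n i j x y : i + n <= dom x -> j + n <= cod x ->
  iter n (tr i j) (pcat x y) = pcat (iter n (tr i j) x) y.
Proof.
elim: n => [|n IHn] // lti ltj; rewrite !addnS in lti ltj.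
have [dn cn] := arity_iter_tr i j (leq_trans (leq_addl i n) (ltnW lti))
                                  (leq_trans (leq_addl j n) (ltnW ltj)).
rewrite !iterS IHn ?(ltnW lti) ?(ltnW ltj) //.
by rewrite tr_pcatl ?dn ?cn // ltn_subRL addnC.
Qed.

Lemma iter_tr_pcatr n i j x y : i + n <= dom y -> j + n <= cod y ->
  iter n (tr (dom x + i) (cod x + j)) (pcat x y) = pcat x (iter n (tr i j) y).
Proof.
elim: n => [|n IHn] // lti ltj; rewrite !addnS in lti ltj.
have [dn cn] := arity_iter_tr i j (leq_trans (leq_addl i n) (ltnW lti))
                                  (leq_trans (leq_addl j n) (ltnW ltj)).
rewrite !iterS IHn ?(ltnW lti) ?(ltnW ltj) //.
by rewrite tr_pcatr ?dn ?cn // ltn_subRL addnC.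
Qed.

(** Sliding past one copy of T = tr k 0 decreases the two indices of the
    innermost trace by one; after l copies it has become T itself. *)
Lemma iter_slide k l x : k + l < dom x -> l < cod x ->
  iter l (tr k 0) (tr (k + l) l x) = iter l.+1 (tr k 0) x.
Proof.
elim: l x => [|l IHl] x ltd ltc; first by rewrite addn0.
have cx : 0 < cod x by exact: leq_trans ltc.
have dx : 0 < dom x by exact: leq_trans ltd.
rewrite addnS in ltd *.
rewrite iterSr tr_tr ?ltc ?ltnS ?leq_addr ?ltd //= IHl -?iterSr //.
  by rewrite dom_tr // ltn_predRL.
by rewrite cod_tr // ltn_predRL.
Qed.

(** Each of the m inner traces becomes, after sliding to the outside, one more
    copy of T = tr k 0. *)
Lemma iter_slide_iter k l m x : k + l + m <= dom x -> l + m <= cod x ->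
  iter l (tr k 0) (iter m (tr (k + l) l) x) = iter (m + l) (tr k 0) x.
Proof.
elim: m => [|m IHm] // ltd ltc; rewrite !addnS in ltd ltc.
have [dm cm] := arity_iter_tr (k + l) l
  (leq_trans (leq_addl _ m) (ltnW ltd)) (leq_trans (leq_addl _ m) (ltnW ltc)).
rewrite iterS iter_slide ?dm ?cm; last 2 first.
- by rewrite ltn_subRL addnC.
- by rewrite ltn_subRL addnC.
by rewrite iterS IHm // ltnW.
Qed.

(** The defining traces of indices k + l - 1, ..., k are turned one after the
    other into traces of index k. *)
Lemma pack_iter_ptrace k l m (x : P (k + l) (l + m)) :
  pack (iter_ptrace x) = iter l (tr k 0) (pack x).
Proof.
elim: l x => [|l IHl] x /=; first by rewrite pack_cast.
rewrite IHl -[RHS]/(iter l.+1 (tr k 0) (pack x)) -iter_slide.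
- by rewrite -(pack_cast (addnS k l) (addSn l m) x).
- by rewrite /dom /= addnS ltnS.
- by rewrite /cod /= addSn ltnS leq_addr.
Qed.

Lemma pack_vcomp k l m (q : P l m) (p : P k l) :
  pack (vcomp q p) = iter l (tr k 0) (pcat (pack p) (pack q)).
Proof. by rewrite /vcomp pack_iter_ptrace. Qed.

(** Both sides are the (m + l)-th iterate of T = tr k 0 on p * q * r: the m
    traces in r o q become traces of indices k + l and l once p stands on the
    left, and these slide into T. *)
Lemma vcompA k l m n (p : P k l) (q : P l m) (r : P m n) :
  vcomp r (vcomp q p) = vcomp (vcomp r q) p.
Proof.
apply: pack_inj; rewrite !pack_vcomp.
rewrite -iter_tr_pcatl ?leq_addr // -iterD.
have := @iter_tr_pcatr m l 0 (pack p) (pcat (pack q) (pack r)).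
rewrite /dom /cod /= addn0 => <-; rewrite ?leq_addr //.
rewrite iter_slide_iter -?pcatA // /dom /cod /=.
  by rewrite addnA.
by rewrite leq_add2l leq_addr.
Qed.

(** * Units *)

Variable I : P 1 1.
Hypothesis I_unit : is_trap_unit I.

Lemma pack_hpowSr n : pack (hpow I n.+1) = pcat (pack (hpow I n)) (pack I).
Proof.
elim: n => [|n IHn]; first by rewrite pcat1p; apply: (pcatp1 (pack I)).
rewrite -[LHS]/(pcat (pack I) (pack (hpow I n.+1))).
by rewrite {1}IHn pcatA.
Qed.

Lemma tr_pcat_unit k l (p : P k l.+1) :
  tr k 0 (pcat (pack p) (pack I))
    = pack (actl (interval_cycle l.+1 0 l)^-1%g p).
Proof.
rewrite -[pcat _ _](pack_cast (addn1 k) (addn1 l.+1) (hcat p I)).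
have := @ptrace_hcat_unit_out _ _ I_unit _ _ p ord0 isT => /= <-.
by congr (pack (ptrace _ _ _)); apply: val_inj; rewrite /= inordK.
Qed.

Lemma tr_unit_pcat k l (p : P k.+1 l) :
  tr k.+1 0 (pcat (pack I) (pack p))
    = pack (actr p (interval_cycle k.+1 0 k)^-1%g).
Proof.
have := @ptrace_unit_hcat_in _ _ I_unit _ _ p ord_max isT => /= <-.
by congr (pack (ptrace _ _ _)); apply: val_inj; rewrite /= inordK.
Qed.

(** The copies of I that have not been reached yet sit to the right of
    p * I, hence do not see the permutation that its trace produces: p can be
    replaced by its rotation in the induction. *)
Lemma iter_tr_pcat_hpow k l n (p : P k l.+1) :
  iter n (tr k 0) (pcat (pack p) (pack (hpow I n)))
    = pack (actl ((interval_cycle l.+1 0 l)^-1 ^+ n)%g p).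
Proof.
elim: n p => [|n IHn] p; first by rewrite expg0 actl1; apply: pcatp1.
rewrite iterSr [pack (hpow I n.+1)]/(pcat (pack I) (pack (hpow I n))) pcatA.
rewrite tr_pcatl ?tr_pcat_unit ?IHn; last 2 first.
- by rewrite /dom /= addn1.
- by [].
by rewrite -actlM -expgS.
Qed.

(** The traces are taken here in the order of the definition of the vertical
    concatenation: the first one then stays within the rightmost factor
    I * p, and never has to cross the permutations produced by the others. *)
Lemma iter_tr_hpow_pcat k l n (p : P k.+1 l) :
  iter n (tr k.+1 0) (pcat (pack (hpow I n)) (pack p))
    = pack (actr p ((interval_cycle k.+1 0 k)^-1 ^+ n)%g).
Proof.
elim: n p => [|n IHn] p; first by rewrite expg0 actr1; apply: pcat1p.
rewrite pack_hpowSr -pcatA -iter_slide; last 2 first.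
- by rewrite /dom /= addnC ltn_add2l.
- by rewrite /cod /= -addSnnS leq_addr.
have tr_last : tr (n + k.+1) (n + 0)
    (pcat (pack (hpow I n)) (pcat (pack I) (pack p)))
      = pcat (pack (hpow I n)) (tr k.+1 0 (pcat (pack I) (pack p))).
  exact: tr_pcatr.
rewrite [n + k.+1]addnC addn0 in tr_last.
by rewrite tr_last tr_unit_pcat IHn -actrM -expgSr.
Qed.

Lemma vcomp_hpowl k l (p : P k l) : vcomp (hpow I l) p = p.
Proof.
apply: pack_inj; rewrite pack_vcomp.
case: l p => [|l] p; first exact: pcatp1.
by rewrite iter_tr_pcat_hpow expgVn interval_cycle_expgn invg1 actl1.
Qed.

Lemma vcomp_hpowr k l (p : P k l) : vcomp p (hpow I k) = p.
Proof.
apply: pack_inj; rewrite pack_vcomp.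
case: k p => [|k] p; first exact: pcat1p.
by rewrite iter_tr_hpow_pcat expgVn interval_cycle_expgn invg1 actr1.
Qed.

End Packing.

Theorem proposition4p1p1 (P : trap) :
  (forall (k l m n : nat) (p : P k l) (q : P l m) (r : P m n),
      vcomp r (vcomp q p) = vcomp (vcomp r q) p)
  /\
  (forall I : P 1 1, is_trap_unit I ->
    forall (k l : nat) (p : P k l),
      vcomp (hpow I l) p = p /\ vcomp p (hpow I k) = p).
Proof.
split; first exact: vcompA.
by move=> I I_unit k l p; rewrite vcomp_hpowl ?vcomp_hpowr.
Qed.
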